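(* Let $p$ be an odd prime, let $G$ be a quasi-powerful $p$-group and let $i$ be a non-negative integer. Then: (i) if $a,b\in G$ both have order at most $p^{i}$, then their product $ab$ has order at most $p^{i}$; (ii) $G^{p^{i}}=\{g^{p^{i}}\mid g\in G\}$, i.e. the subgroup generated by the $p^{i}$th powers coincides with the set of $p^{i}$th powers; (iii) $|G:G^{p^{i}}|=|\Omega_{i}(G)|$. In particular, $G$ has a regular power structure.
   Context: For an odd prime $p$, a finite $p$-group $G$ is powerful if $[G,G]\le G^{p}$, and $G$ is quasi-powerful if $G/Z(G)$ is powerful. For a finite $p$-group $G$, $G^{p^{i}}=\langle g^{p^{i}}\mid g\in G\rangle$ and $\Omega_{i}(G)=\langle g\in G\mid g^{p^{i}}=1\rangle$. A finite $p$-group $G$ has a regular power structure if for all positive integers $i$: $G^{p^{i}}=\{g^{p^{i}}\mid g\in G\}$, $\Omega_{i}(G)=\{g\in G\mid o(g)\le p^{i}\}$, and $|G:G^{p^{i}}|=|\Omega_{i}(G)|$. *)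

(* Defs.v *)
From mathcomp Require Import all_boot all_fingroup all_solvable.
Set Implicit Arguments. Unset Strict Implicit. Unset Printing Implicit Defensive.
Local Open Scope group_scope.

Definition pow_subgroup (gT : finGroupType) (G : {set gT}) (n : nat) : {set gT} :=
  <<[set x ^+ n | x in G]>>.

Definition Omega_sub (gT : finGroupType) (p i : nat) (G : {set gT}) : {set gT} :=
  <<[set x in G | x ^+ (p ^ i) == 1]>>.

(* G is powerful (p odd): [G,G] <= G^p *)
Definition powerful (gT : finGroupType) (p : nat) (G : {set gT}) : bool :=
  [~: G, G] \subset pow_subgroup G p.

Definition quasi_powerful (gT : finGroupType) (p : nat) (G : {group gT}) : bool :=
  powerful p (G / 'Z(G)).

Definition regular_power_structure (gT : finGroupType) (p : nat) (G : {group gT}) : Prop :=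
  forall i : nat, 0 < i ->
    [/\ pow_subgroup G (p ^ i) = [set x ^+ (p ^ i) | x in G],
        Omega_sub p i G = [set x in G | #[x] <= p ^ i]
      & #|G : pow_subgroup G (p ^ i)| = #|Omega_sub p i G| ].

(* Main.v *)
(* Write Z for the center and M = G^p Z. Modulo suitable terms, x |-> x^p is a
   homomorphism because p is odd, so p divides 'C(p, 2) in
   (yx)^p = y^p x^p [x,y]^'C(p, 2). This gives [M, G] <= M^p, so that for every
   x the subgroup <x>M is powerful, with (<x>M)^p = M^p as soon as x^p is in
   M^p. In a nonabelian powerful group <x>G^p is a proper subgroup, so
   statements about p-th powers go by induction from the subgroups <x>M to G.

   Products of elements of order p are controlled by the commutator estimate:
   if h^(p^(i+1)) and b^(p^i) are in Z then [h^(p^j), b^(p^k)] = 1 whenever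
   j + k = i. It is proved by downward induction on i: with i = j + k + 1,
   g = h^(p^j), e = b^(p^k) and u = [g, e], the case i + 1 shows that [u, g] and
   [u, e] commute with g, e and u, hence [g^p, e] = u^p = [g, e^p], and p-th
   powers can be moved from h to b until b^(p^i), which is central, is reached.
   This needs u^p to be in Z; for a powerful group (with Z replaced by 1) that
   follows by induction on the order, using <b>G^p if i = 1 and G / Omega_1(G^p)
   if i > 1, and for a quasi-powerful group it is the powerful case of G / Z.

   Orders at most p^i then follow through G / Omega_(i-1)(G), and the index
   formula reduces to i = 1, where the kernel of the homomorphism
   x |-> x^p M^p from G to G^p / M^p is Omega_1(G) M. *)

Require Import Defs.
From mathcomp Require Import all_boot all_fingroup all_solvable.
Set Implicit Arguments. Unset Strict Implicit. Unset Printing Implicit Defensive.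
Local Open Scope group_scope.

(** * Powers of products, and induction for powerful p-groups *)

Lemma powMp (gT : finGroupType) (p : nat) (x y : gT) :
    prime p -> odd p -> commute x [~ x, y] -> commute y [~ x, y] ->
    [~ x, y] ^+ p = 1 ->
  (y * x) ^+ p = y ^+ p * x ^+ p.
Proof.
move=> p_pr p_odd cx cy zp; rewrite expMg_Rmul //.
have /dvdnP[k ->]: p %| 'C(p, 2).
  by rewrite prime_dvd_bin //= (odd_prime_gt2 p_odd).
by rewrite mulnC expgM zp expg1n mulg1.
Qed.

Lemma powMp_mod (gT : finGroupType) (p : nat) (L : {group gT}) (x y : gT) :
    prime p -> odd p -> x \in 'N(L) -> y \in 'N(L) ->
    [~ x, y, x] \in L -> [~ x, y, y] \in L -> [~ x, y] ^+ p \in L ->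
  (y ^+ p * x ^+ p)^-1 * (y * x) ^+ p \in L.
Proof.
move=> p_pr p_odd nLx nLy Lx Ly Lp.
have nLz: [~ x, y] \in 'N(L) by rewrite groupR.
apply: coset_idr; first by rewrite !(groupM, groupV, groupX).
rewrite morphM ?(groupM, groupV, groupX) // morphV ?(groupM, groupX) //.
apply/eqP; rewrite -eq_mulVg1 eq_sym morphM ?(groupM, groupX) //.
rewrite !morphX ?groupM // morphM //; apply/eqP/powMp=> //; rewrite -morphR //.
- by apply: commute_sym; apply/commgP; rewrite -morphR //= coset_id.
- by apply: commute_sym; apply/commgP; rewrite -morphR //= coset_id.
by rewrite -morphX //= coset_id.
Qed.

Lemma mem_Mho_pow (gT : finGroupType) (p n : nat) (G : {group gT}) x :
  p.-group G -> x \in G -> x ^+ (p ^ n) \in 'Mho^n(G).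
Proof. by move=> pG Gx; apply: Mho_p_elt (mem_p_elt pG Gx). Qed.

Lemma mem_Mho1 (gT : finGroupType) (p : nat) (G : {group gT}) x :
  p.-group G -> x \in G -> x ^+ p \in 'Mho^1(G).
Proof. by move=> pG Gx; rewrite -[p in _ ^+ p]expn1 (mem_Mho_pow 1 pG). Qed.

(** In [G / K] the image of [X] lies in its own commutator with the whole group; nilpotency leaves
    only the trivial group. *)
Lemma nil_sub_mod (gT : finGroupType) (G X K : {group gT}) :
  nilpotent G -> K <| G -> X <| G -> X \subset [~: X, G] <*> K -> X \subset K.
Proof.
move=> nilG /andP[sKG nKG] /andP[sXG nXG] sX.
have nKX := subset_trans sXG nKG.
rewrite -quotient_sub1 // subG1; apply: contraTT isT => ntX.
have := nil_comm_properl (quotient_nil K nilG) (quotientS K sXG) ntX.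
move/(_ (G / K)%g); rewrite subsetI subxx quotient_norms // => /(_ isT).
rewrite -quotientR // properE => /andP[_ /negP[]].
apply: subset_trans (quotientS K sX) _.
have nKR: [~: X, G] \subset 'N(K) by rewrite comm_subG.
by rewrite norm_joinEl // quotientMidr.
Qed.

(** Strong induction on the order, over all group types because quotients change the type. The
    abelian case is split off since there [<[x]> <*> 'Mho^1(G)] can be all of [G]. *)
Lemma powerful_ind (p : nat) (P : forall gT : finGroupType, {group gT} -> Prop) :
    (forall gT (G : {group gT}), p.-group G -> abelian G -> P gT G) ->
    (forall gT (G : {group gT}),
       p.-group G -> ~~ abelian G -> [~: G, G] \subset 'Mho^1(G) ->
       (forall rT (H : {group rT}), p.-group H -> [~: H, H] \subset 'Mho^1(H) ->
          #|H| < #|G| -> P rT H) ->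
     P gT G) ->
  forall gT (G : {group gT}), p.-group G -> [~: G, G] \subset 'Mho^1(G) -> P gT G.
Proof.
move=> Pab Pnab gT G; have [n] := ubnP #|G|.
elim: n gT G => // n IHn gT G leGn pG powG.
have [cGG | nabG] := boolP (abelian G); first exact: Pab.
by apply: Pnab => // rT H pH powH ltHG; apply: IHn => //; apply: leq_trans ltHG _.
Qed.

(** * Powerfully embedded subgroups and p-th powers *)

Section PowerfulEmbedding.

Variables (gT : finGroupType) (p : nat).
Hypotheses (p_pr : prime p) (p_odd : odd p).
Implicit Types G A B C H K L M P Z : {group gT}.

(** p-th powers generate ['Mho^1(A)], so centralizing [C] modulo [L] can be tested on them. *)
Lemma Mho1_commg_sub A C L :
    p.-group A -> A \subset 'N(L) -> C \subset 'N(L) ->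
    {in A & C, forall x g, [~ x ^+ p, g] \in L} ->
  [~: 'Mho^1(A), C] \subset L.
Proof.
move=> pA nLA nLC sAC; have nLM := subset_trans (Mho_sub 1 A) nLA.
rewrite -quotient_cents2 // (MhoE 1 pA) quotient_gen; last first.
  by apply: subset_trans nLM; rewrite (MhoE 1 pA) subset_gen.
rewrite gen_subG; apply/subsetP=> _ /morphimP[_ _ /imsetP[x Ax ->] ->].
apply/centP=> _ /morphimP[g nLg Cg ->].
have nLx: x \in 'N(L) by apply: subsetP Ax.
apply/commgP; rewrite -morphR ?groupX //= coset_id // expn1.
exact: sAC.
Qed.

(* By nilpotency it suffices to work modulo [B, G, G], where commutators with
   elements of B are central. *)
Lemma Mho1_join_commg_sub G A B Z :
    p.-group G -> A <| G -> B <| G -> [~: A, G] \subset B ->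
    Z \subset 'Z(G) -> B \subset 'Mho^1(A) * Z ->
  [~: B, G] \subset 'Mho^1(B).
Proof.
move=> pG nsAG nsBG sAGB sZ sB.
have [[sAG nAG] [sBG nBG]] := (andP nsAG, andP nsBG).
have [pA pB] := (pgroupS sAG pG, pgroupS sBG pG).
have nM: 'Mho^1(B) <| G by apply: gFnormal_trans.
have sBG_B: [~: B, G] \subset B by rewrite commg_subl.
have nR: [~: B, G] <| G.
  by rewrite /normal (subset_trans sBG_B) //= commg_normr.
have nRR: [~: B, G, G] <| G.
  rewrite /normal (subset_trans (commSg _ sBG_B)) ?(subset_trans sBG_B) //=.
  exact: commg_normr.
pose L := ([~: B, G, G] <*> 'Mho^1(B))%G.
suffices sRL: [~: B, G] \subset L by apply: nil_sub_mod (pgroup_nil pG) nM nR sRL.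
have nL : G \subset 'N(L) by rewrite normsY ?normal_norm.
have LRR x g : x \in [~: B, G] -> g \in G -> [~ x, g] \in L.
  by move=> Rx Gg; apply: mem_gen; rewrite inE mem_commg.
have LM x : x \in B -> x ^+ p \in L.
  by move=> Bx; apply: mem_gen; rewrite inE mem_Mho1 ?orbT.
(* With [u = [~ x, g]] in [B], the conjugate of [x ^+ p] by [g] is [(x * u) ^+ p], which is
   [x ^+ p * u ^+ p] modulo [L]. Hence [[~ x ^+ p, g]] is [u ^+ p] modulo [L], and that lies in
   [L]. *)
have cent1 : [~: 'Mho^1(A), G] \subset L.
  apply: Mho1_commg_sub; rewrite ?(subset_trans sAG) // => x g Ax Gg.
  have Gx := subsetP sAG x Ax.
  have Bu: [~ x, g] \in B by rewrite (subsetP sAGB) ?mem_commg.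
  have Gu := subsetP sBG _ Bu.
  have: (x ^+ p * [~ x, g] ^+ p)^-1 * (x * [~ x, g]) ^+ p \in L.
    apply: powMp_mod; rewrite ?(subsetP nL) ?LRR ?LM ?mem_commg //.
    by rewrite (subsetP sBG_B) ?mem_commg.
  rewrite -conjg_mulR -conjXg invMg -mulgA -commgEl => Lu.
  by rewrite -[[~ _, _]](mulKVg ([~ x, g] ^+ p)) groupM // LM.
have sMG: 'Mho^1(A) \subset G by apply: gFsub_trans.
rewrite -quotient_cents2 ?(subset_trans sMG) // in cent1.
rewrite -quotient_cents2 ?(subset_trans sBG) //.
apply: subset_trans (quotientS _ sB) _.
rewrite quotientMl ?(subset_trans sMG) // mul_subG //.
have [sZG cZG]: Z \subset G /\ Z \subset 'C(G) by apply/andP; rewrite -subsetI.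
by rewrite quotient_cents.
Qed.

(** Modulo ['Mho^1(M)] the subgroup [M] is central, so the join becomes cyclic times central, hence
    abelian. *)
Lemma join_cycle_der1 G M x :
    M <| G -> [~: M, G] \subset 'Mho^1(M) -> x \in G ->
  [~: <[x]> <*> M, <[x]> <*> M] \subset 'Mho^1(M).
Proof.
move=> nsMG sMG Gx; have [sMsG nMG] := andP nsMG.
have sXG: <[x]> \subset G by rewrite cycle_subG.
have nLG: G \subset 'N('Mho^1(M)) by rewrite gFnorm_trans.
have cMG: M / 'Mho^1(M) \subset 'C(G / 'Mho^1(M)) by apply: quotient_cents2r.
rewrite norm_joinEl ?(subset_trans sXG) //.
rewrite -quotient_cents2 ?mul_subG ?(subset_trans sXG) ?(subset_trans sMsG) //.
have nLX := subset_trans sXG nLG.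
rewrite quotientMl //; change (abelian ((<[x]> / 'Mho^1(M)) * (M / 'Mho^1(M)))).
rewrite abelianM quotient_abelian ?cycle_abelian //=.
by rewrite /abelian !(subset_trans cMG) ?centS ?quotientS //.
Qed.

(** Elements of the join have the form [x ^+ j * m]. Its commutators lie in ['Mho^1(M)], so modulo
    this subgroup the p-th power is the product of the p-th powers, both of which vanish there. *)
Lemma join_cycle_Mho1 G M x :
    p.-group G -> M <| G -> [~: M, G] \subset 'Mho^1(M) -> x \in G ->
    x ^+ p \in 'Mho^1(M) ->
  'Mho^1(<[x]> <*> M) = 'Mho^1(M).
Proof.
move=> pG nsMG sMG Gx xpM; have [sMsG nMG] := andP nsMG.
have sXG: <[x]> \subset G by rewrite cycle_subG.
have nLG: G \subset 'N('Mho^1(M)) by rewrite gFnorm_trans.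
apply/eqP; rewrite eqEsubset andbC MhoS ?joing_subr //=.
have sPG: <[x]> <*> M \subset G by rewrite join_subG sXG.
have der := join_cycle_der1 nsMG sMG Gx.
rewrite (MhoE 1 (pgroupS sPG pG)) gen_subG expn1.
apply/subsetP=> _ /imsetP[z Pz ->].
have: z \in <[x]> * M by rewrite -norm_joinEl // (subset_trans sXG).
case/mulsgP=> _ m /cycleP[j ->] Mm defz.
have Px: x ^+ j \in <[x]> <*> M.
  by rewrite groupX // (subsetP (joing_subl _ _)) ?cycle_id.
have Pm: m \in <[x]> <*> M by rewrite (subsetP (joing_subr _ _)).
have Lc: [~ m, x ^+ j] \in 'Mho^1(M) by rewrite (subsetP der) ?mem_commg.
have Lc' y : y \in <[x]> <*> M -> [~ m, x ^+ j, y] \in 'Mho^1(M).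
  move=> Py; rewrite (subsetP der) ?mem_commg //.
  by rewrite (subsetP (subset_trans (Mho_sub 1 M) (joing_subr _ _))).
have: ((x ^+ j) ^+ p * m ^+ p)^-1 * (x ^+ j * m) ^+ p \in 'Mho^1(M).
  apply: powMp_mod; rewrite ?Lc' // ?groupX //.
    exact: (subsetP nLG) _ (subsetP sMsG _ Mm).
  exact: (subsetP nLG) _ Gx.
have Lm: m ^+ p \in 'Mho^1(M) := mem_Mho1 (pgroupS sMsG pG) Mm.
by rewrite -defz groupMl // groupV groupM // -expgM mulnC expgM groupX.
Qed.

Definition pow_closed G :=
  forall y, y \in 'Mho^1(G) -> exists2 x, x \in G & y = x ^+ p.

(** Modulo ['Mho^1(M)] all commutators of [G] lie in the image of [M], which is central with trivial
    p-th powers. *)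
Lemma powM_mod_Mho1 G M x y :
    p.-group G -> M <| G -> [~: M, G] \subset 'Mho^1(M) ->
    [~: G, G] \subset M -> x \in G -> y \in G ->
  (x ^+ p * y ^+ p)^-1 * (x * y) ^+ p \in 'Mho^1(M).
Proof.
move=> pG nsMG sMG sGM Gx Gy; have [sMsG nMG] := andP nsMG.
have nLG: G \subset 'N('Mho^1(M)) by rewrite gFnorm_trans.
have Mc: [~ y, x] \in M by rewrite (subsetP sGM) ?mem_commg.
apply: powMp_mod; rewrite ?(subsetP nLG) ?(mem_Mho1 (pgroupS sMsG pG)) //.
  by rewrite (subsetP sMG) ?mem_commg.
by rewrite (subsetP sMG) ?mem_commg.
Qed.

(** The product [x ^+ p * y ^+ p] differs from [(x * y) ^+ p] by an element of ['Mho^1(M)], so it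
    lies in ['Mho^1] of [<[x * y]> <*> M], where it is already a p-th power. *)
Lemma pow_closed_lift G M :
    p.-group G -> M <| G -> [~: M, G] \subset 'Mho^1(M) ->
    [~: G, G] \subset M -> {in G, forall x, pow_closed (<[x]> <*> M)} ->
  pow_closed G.
Proof.
move=> pG nsMG sMG sGM powP; have [sMsG nMG] := andP nsMG.
suffices gP: group_set [set x ^+ p | x in G].
  move=> y; rewrite (MhoE 1 pG) expn1 (gen_set_id gP).
  by case/imsetP=> x Gx ->; exists x.
apply/group_setP; split; first by apply/imsetP; exists 1; rewrite ?expg1n.
move=> _ _ /imsetP[x Gx ->] /imsetP[y Gy ->].
have Gxy: x * y \in G by rewrite groupM.
have sPG: <[x * y]> <*> M \subset G by rewrite join_subG cycle_subG Gxy.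
have [|z Pz defz] := powP _ Gxy (x ^+ p * y ^+ p).
  have:= powM_mod_Mho1 pG nsMG sMG sGM Gx Gy.
  move/(subsetP (MhoS 1 (joing_subr <[x * y]> M))).
  rewrite groupMr ?groupV // (mem_Mho1 (pgroupS sPG pG)) //.
  by rewrite (subsetP (joing_subl _ _)) ?cycle_id.
by apply/imsetP; exists z; rewrite ?(subsetP sPG).
Qed.

(** For powerful [G] the Frattini subgroup is ['Mho^1(G)]. If it generated [G] together with [x],
    then [x] alone would, and [G] would be cyclic. *)
Lemma Mho1_cycle_join_proper G x :
    p.-group G -> [~: G, G] \subset 'Mho^1(G) -> ~~ abelian G -> x \in G ->
  #|<[x]> <*> 'Mho^1(G)| < #|G|.
Proof.
move=> pG powG nabG Gx.
have sPG: <[x]> <*> 'Mho^1(G) \subset G by rewrite join_subG cycle_subG Gx Mho_sub.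
apply: proper_card; rewrite properE sPG; apply: contra nabG => sGP.
have defG: 'Phi(G) <*> <[x]> = G.
  rewrite (Phi_joing pG) (joing_idPr powG) joingC; apply/eqP.
  by rewrite eqEsubset sPG.
by move/Phi_nongen: defG; rewrite genGid => <-; apply: cycle_abelian.
Qed.

Lemma powerful_Mho1_commg G :
    p.-group G -> [~: G, G] \subset 'Mho^1(G) ->
  [~: 'Mho^1(G), G] \subset 'Mho^1('Mho^1(G)).
Proof.
move=> pG powG; apply: (@Mho1_join_commg_sub G G _ 1) => //.
- exact: gFnormal.
- exact: sub1G.
- by rewrite mulg1.
Qed.

End PowerfulEmbedding.

Lemma powerful_pow_closed (gT : finGroupType) (p : nat) (G : {group gT}) :
    prime p -> odd p ->
    p.-group G -> [~: G, G] \subset 'Mho^1(G) ->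
  pow_closed p G.
Proof.
move=> p_pr p_odd; move: gT G; apply: powerful_ind.
  move=> gT G pG cGG y.
  by rewrite (MhoEabelian 1 pG cGG) expn1 => /imsetP[x Gx ->]; exists x.
move=> gT G pG nabG powG IH.
have M_G := powerful_Mho1_commg p_pr p_odd pG powG.
have nsMG: 'Mho^1(G) <| G by apply: gFnormal.
apply: (pow_closed_lift p_pr p_odd pG nsMG) => // x Gx; apply: IH.
- by rewrite (pgroupS _ pG) // join_subG cycle_subG Gx Mho_sub.
- by rewrite (subset_trans (join_cycle_der1 nsMG M_G Gx)) // MhoS ?joing_subr.
- exact: Mho1_cycle_join_proper pG powG nabG Gx.
Qed.

(** * Iterated power subgroups of quasi-powerful groups *)

Section QuasiPowerful.

Variables (gT : finGroupType) (p : nat).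
Hypotheses (p_pr : prime p) (p_odd : odd p).
Implicit Types G A B C H K L M P Z : {group gT}.

(* Equivalent to G / 'Z(G) being powerful, see quasi_center_quotient. *)
Definition quasi_powerful_Mho G := [~: G, G] \subset 'Mho^1(G) <*> 'Z(G).

Lemma quasi_core_commg G :
    p.-group G -> quasi_powerful_Mho G ->
  [~: 'Mho^1(G) <*> 'Z(G), G] \subset 'Mho^1('Mho^1(G) <*> 'Z(G)).
Proof.
move=> pG qG; apply: (@Mho1_join_commg_sub gT p p_pr p_odd G G _ 'Z(G)) => //.
- by rewrite normalY ?gFnormal.
- rewrite /= cent_joinEr //.
  apply: subset_trans (subsetIr G _) _; rewrite centS //; exact: Mho_sub.
Qed.

(** A single lift suffices: the joins of [<[x]>] with ['Mho^1(G) <*> 'Z(G)] are powerful, and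
    powerful groups are settled. *)
Lemma quasi_pow_closed G : p.-group G -> quasi_powerful_Mho G -> pow_closed p G.
Proof.
move=> pG qG; have M_G := quasi_core_commg pG qG.
have nsMG: 'Mho^1(G) <*> 'Z(G) <| G by rewrite normalY ?gFnormal.
apply: (pow_closed_lift p_pr p_odd pG nsMG) => // x Gx.
apply: (powerful_pow_closed p_pr p_odd).
  by rewrite (pgroupS _ pG) // join_subG cycle_subG Gx normal_sub.
by rewrite (subset_trans (join_cycle_der1 nsMG M_G Gx)) // MhoS ?joing_subr.
Qed.

(** ['Mho^1(G) <*> 'Z(G)] is a central product, so its ['Mho^1] is that of ['Mho^1(G)] times that of
    ['Z(G)]; the second factor lies in the center of ['Mho^1(G)]. *)
Lemma quasi_Mho1 G :
  p.-group G -> quasi_powerful_Mho G -> quasi_powerful_Mho ('Mho^1(G))%G.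
Proof.
move=> pG qG; have M_G := quasi_core_commg pG qG.
have cMZ: 'Z(G) \subset 'C('Mho^1(G)).
  by apply: subset_trans (subsetIr G _) _; rewrite centS ?Mho_sub.
have defM: 'Mho^1(G) \* 'Z(G) = 'Mho^1(G) <*> 'Z(G).
  by rewrite cprodE // cent_joinEr.
have /cprodP[_ defM1 _] := Mho_cprod 1 defM.
have sM : [~: 'Mho^1(G), 'Mho^1(G)] \subset 'Mho^1('Mho^1(G) <*> 'Z(G)).
  by apply: subset_trans M_G; rewrite commgSS ?joing_subl ?Mho_sub.
apply: subset_trans sM _.
rewrite -defM1 mul_subG ?joing_subl //; apply: subset_trans (joing_subr _ _).
rewrite subsetI MhoS ?subsetIl //=.
exact: subset_trans (Mho_sub 1 _) cMZ.
Qed.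

(** The three claims feed each other: quasi-powerfulness at level [n] makes the next level consist
    of powers, and this identifies the iterated power subgroup with ['Mho^n.+1(G)]. *)
Lemma quasi_Mho G n : p.-group G -> quasi_powerful_Mho G ->
  [/\ quasi_powerful_Mho ('Mho^n(G))%G, 'Mho^1('Mho^n(G)) = 'Mho^n.+1(G)
    & forall y, y \in 'Mho^n(G) -> exists2 x, x \in G & y = x ^+ (p ^ n)].
Proof.
move=> pG qG; have pM k : p.-group 'Mho^k(G) := pgroupS (Mho_sub k G) pG.
have step k : (forall y, y \in 'Mho^k(G) -> exists2 x, x \in G & y = x ^+ (p ^ k)) ->
   'Mho^1('Mho^k(G)) = 'Mho^k.+1(G).
  move=> Pk; apply/eqP; rewrite eqEsubset (MhoE 1 (pM k)) gen_subG.
  apply/andP; split; first apply/subsetP=> _ /imsetP[y /Pk[x Gx ->] ->].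
    by rewrite -expgM -expnD addn1 (mem_Mho_pow _ pG).
  rewrite (MhoE k.+1 pG) gen_subG; apply/subsetP=> _ /imsetP[x Gx ->].
  rewrite mem_gen // -addn1 expnD expgM; apply: imset_f.
  exact: mem_Mho_pow.
elim: n => [|n [qn defn Pn]].
  have P0: forall y, y \in 'Mho^0(G) -> exists2 x, x \in G & y = x ^+ (p ^ 0).
    by move=> y; rewrite Mho0 => Gy; exists y; rewrite ?expg1.
  by split=> //; [rewrite /quasi_powerful_Mho /= Mho0 | apply: step].
have Pn1: forall y, y \in 'Mho^n.+1(G) -> exists2 x, x \in G & y = x ^+ (p ^ n.+1).
  move=> y; rewrite -defn => /(quasi_pow_closed (pM n) qn)[z /Pn[x Gx ->] ->].
  by exists x; rewrite // -expgM expnSr.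
split=> //; last exact: step.
by rewrite /quasi_powerful_Mho /= -defn; apply: (quasi_Mho1 (pM n)).
Qed.

Lemma powerful_quasi G : [~: G, G] \subset 'Mho^1(G) -> quasi_powerful_Mho G.
Proof. by move=> powG; apply: subset_trans powG (joing_subl _ _). Qed.

(** After the case [k = 0], induct on [k]: modulo ['Mho^(j + k).+2(G)] the commutator [[~ a, c]] is
    central, so passing from [c] to [c ^+ p] raises it to the p-th power. *)
Lemma powerful_Mho_commg G j k :
    p.-group G -> [~: G, G] \subset 'Mho^1(G) ->
  [~: 'Mho^j(G), 'Mho^k(G)] \subset 'Mho^(j + k).+1(G).
Proof.
move=> pG powG; have pM n : p.-group 'Mho^n(G) := pgroupS (Mho_sub n G) pG.
have MM n : 'Mho^1('Mho^n(G)) = 'Mho^n.+1(G).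
  by have [] := quasi_Mho n pG (powerful_quasi powG).
have emb n : [~: 'Mho^n(G), G] \subset 'Mho^n.+1(G).
  elim: n => [|n IHn]; first by rewrite Mho0.
  rewrite -(MM n.+1).
  apply: (@Mho1_join_commg_sub gT p p_pr p_odd G 'Mho^n(G) _ 1) => //;
    rewrite ?gFnormal ?sub1G //.
  by rewrite mulg1 MM.
elim: k => [|k IHk]; first by rewrite Mho0 addn0.
have nLG: G \subset 'N('Mho^(j + k).+2(G)) by apply: gFnorm.
rewrite -(MM k) commGC addnS.
apply: (Mho1_commg_sub (pM k) (subset_trans (Mho_sub k G) nLG)).
  exact: subset_trans (Mho_sub j G) nLG.
move=> c a Mc Ma.
have Lu: [~ a, c] \in 'Mho^(j + k).+1(G) by rewrite (subsetP IHk) ?mem_commg.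
have Gu: [~ a, c] \in G by rewrite (subsetP (Mho_sub _ _) _ Lu).
have [Gc Ga] := (subsetP (Mho_sub _ _) _ Mc, subsetP (Mho_sub _ _) _ Ma).
have cuc: commute (coset 'Mho^(j + k).+2(G) c) [~ coset _ c, coset _ a].
  apply/commgP; rewrite -!morphR ?(subsetP nLG) ?groupR //= coset_id //.
  rewrite -invg_comm groupV (subsetP (emb _)) ?mem_commg //.
  by rewrite -invg_comm groupV.
apply: coset_idr; first by rewrite groupR ?groupX ?(subsetP nLG).
rewrite morphR ?groupX ?(subsetP nLG) // morphX ?(subsetP nLG) //= commXg //.
rewrite -morphR ?(subsetP nLG) // -morphX ?groupR ?(subsetP nLG) //= coset_id //.
by rewrite -MM (mem_Mho1 (pM _)) // -invg_comm groupV.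
Qed.

End QuasiPowerful.

(** * Commutators of elements of bounded order *)

Section CommutatorOrders.

Variable p : nat.
Hypotheses (p_pr : prime p) (p_odd : odd p).

(** Conjugating [g ^+ p] by [e] gives [(g * [~ g, e]) ^+ p], which [powMp] expands. *)
Lemma commXpg (gT : finGroupType) (g e : gT) :
    commute [~ g, e] [~ g, e, g] -> commute g [~ g, e, g] ->
    [~ g, e, g] ^+ p = 1 ->
  [~ g ^+ p, e] = [~ g, e] ^+ p.
Proof.
move=> cuc cgc cp; rewrite commgEl conjXg conjg_mulR.
by rewrite (powMp p_pr p_odd cuc cgc cp) mulKg.
Qed.

Section Filtered.

Variables (gT : finGroupType) (G Z : {group gT}) (V : nat -> {set gT}).

(* V i plays the role of the subgroup G^(p^i) Z. *)
Hypothesis V_comm : forall i u y, u \in V i -> y \in G -> [~ u, y] \in V i.+1.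
Hypothesis V_pow : forall i u, u \in V i ->
  exists2 w, w \in G & exists2 z, z \in Z & u = w ^+ (p ^ i) * z.

(** The a priori bound for level [i = j + k + 1] of the downward induction. It is used with [Z]
    trivial for powerful groups and [Z] the center for quasi-powerful ones. *)
Definition comm_expp := forall j k h b, h \in G -> b \in G ->
  h ^+ (p ^ (j + k).+2) \in Z -> b ^+ (p ^ (j + k).+1) \in Z ->
  [/\ [~ h ^+ (p ^ j), b ^+ (p ^ k)] \in V (j + k).+1,
      [~ h ^+ (p ^ j), b ^+ (p ^ k)] ^+ p \in Z
    & forall y, y \in G -> [~ h ^+ (p ^ j), b ^+ (p ^ k), y] ^+ p \in Z].

Definition comm_trivial_at i := forall j k h b, j + k = i -> h \in G -> b \in G ->
  h ^+ (p ^ i.+1) \in Z -> b ^+ (p ^ i) \in Z -> [~ h ^+ (p ^ j), b ^+ (p ^ k)] = 1.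

Hypotheses (pG : p.-group G) (cZ : Z \subset 'Z(G)) (expV : comm_expp).

Let cZG z y : z \in Z -> y \in G -> commute z y.
Proof. by move/(subsetP cZ)/setIP=> [_ /centP]; apply. Qed.

Let expZ x m n : x ^+ (p ^ m) \in Z -> m <= n -> x ^+ (p ^ n) \in Z.
Proof. by move=> Zx /subnKC <-; rewrite expnD expgM groupX. Qed.

(** Write [u] as [w ^+ (p ^ i)] times a central element. Since [u ^+ p] is in [Z], so is
    [w ^+ (p ^ i.+1)], and the estimate at level [i] applies to [w] and [y] with [j = i],
    [k = 0]. *)
Lemma filtered_commute i u y :
    comm_trivial_at i -> u \in V i -> u ^+ p \in Z ->
    y \in G -> y ^+ (p ^ i) \in Z ->
  commute u y.
Proof.
move=> Bi Vu Zup Gy Zy; have [w Gw [z Zz defu]] := V_pow Vu.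
have Gwi: w ^+ (p ^ i) \in G by rewrite groupX.
have cwz: commute (w ^+ (p ^ i)) z by apply/commute_sym; apply: cZG.
rewrite defu; apply: commute_sym; apply: commuteM; last first.
  by apply: commute_sym; apply: cZG.
apply/commute_sym/commgP/eqP; rewrite -[y]expg1 -(expn0 p).
apply: Bi; rewrite ?addn0 // expnSr expgM.
by move: Zup; rewrite defu expgMn // groupMr // groupX.
Qed.

Lemma comm_trivial i : comm_trivial_at i.
Proof.
pose n := logn p #|G|.
have G1 x k : x \in G -> n <= k -> x ^+ (p ^ k) = 1.
  move=> Gx /subnKC <-; rewrite expnD expgM -(card_pgroup pG).
  by rewrite expg_cardG // expg1n.
(* For i >= 2n one of j and k is at least n, which starts the downward
   induction. *)
have: n + n <= i + (n + n) by rewrite leq_addl.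
elim: {2}(n + n) i => [|m IHm] i lei.
  move=> j k h b defi Gh Gb _ _; rewrite -defi addn0 in lei.
  have [lenj | ltjn] := leqP n j; first by rewrite (G1 h) // comm1g.
  rewrite (G1 b k) ?commg1 // leqNgt; apply: contraL lei => ltkn.
  by rewrite -ltnNge -addSn leq_add // ltnW.
have {m lei}IHm : comm_trivial_at i.+1 by apply: IHm; rewrite addSnnS.
(* Inner induction on [j] at fixed level [i]: for [j = 0] the power of [b] is central, and the step
   moves one p-th power from [h] to [b]. *)
elim=> [|j IHj] k h b.
  rewrite add0n => <- Gh Gb _ Zb; apply/eqP/commgP.
  by apply: commute_sym; apply: cZG; rewrite // groupX.
move=> defi Gh Gb Zh Zb.
have := IHj k.+1 h b; rewrite addnS -addSn => /(_ defi Gh Gb Zh Zb).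
rewrite !expnSr !expgM; set g := h ^+ _; set e := b ^+ _.
have [Gg Ge] : g \in G /\ e \in G by rewrite !groupX.
rewrite addSn in defi.
have [] : [/\ [~ g, e] \in V i, [~ g, e] ^+ p \in Z
    & forall y, y \in G -> [~ g, e, y] ^+ p \in Z].
  by rewrite -defi; apply: expV; rewrite ?defi.
set u := [~ g, e] => Vu Zup Zuy.
have Gu : u \in G by rewrite groupR.
(* Level [i.+1] is applied to [[~ u, y]], which lies in [V i.+1]; below, [t] is [h], [b] or [u]. *)
have cuy y t : y \in G -> t \in G -> t ^+ (p ^ i.+1) \in Z -> commute t [~ u, y].
  move=> Gy Gt Zt; apply: commute_sym; apply: (filtered_commute IHm) => //.
    exact: V_comm.
  exact: Zuy.
have Zu: u ^+ (p ^ i.+1) \in Z by rewrite expnS expgM groupX.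
have cgy y : y \in G -> commute g [~ u, y].
  by move=> Gy; apply: commute_sym; apply: commuteX; apply: commute_sym; apply: cuy.
have cey y : y \in G -> commute e [~ u, y].
  move=> Gy; apply: commute_sym; apply: commuteX; apply: commute_sym.
  by apply: cuy; rewrite ?(expZ Zb).
have cu y : y \in G -> commute u [~ u, y] by move=> Gy; apply: cuy.
(* This power equals [[~ u ^+ p, y]], and [u ^+ p] is central. *)
have uy1 y : y \in G -> [~ u, y] ^+ p = 1.
  by move=> Gy; rewrite -commXg; [apply/eqP/commgP; apply: cZG | apply: cu].
have -> : [~ g ^+ p, e] = u ^+ p.
  by apply: commXpg; rewrite ?uy1 //; [apply: cu | apply: cgy].
have uVe : [~ u^-1, e] = [~ u, e]^-1 by rewrite commVg //; apply: cu.
suffices -> : [~ g, e ^+ p] = u ^+ p by [].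
(* The same expansion with [g] and [e] exchanged, where [[~ e, g]] is [u^-1]. *)
rewrite -invg_comm commXpg -[[~ e, g]]invg_comm -/u ?uVe.
- by rewrite expgVn invgK.
- apply: commuteV; apply: commute_sym; apply: commuteV; apply: commute_sym; exact: cu.
- by apply: commuteV; apply: cey.
- by rewrite expgVn uy1 ?invg1.
Qed.

(** The estimate at level 1 makes [a] and [b] commute with [[~ b, a]], whose p-th power is then
    [[~ b ^+ p, a] = 1]; so [powMp] applies. *)
Lemma expMp_eq1 a b :
  a \in G -> b \in G -> a ^+ p = 1 -> b ^+ p = 1 -> (a * b) ^+ p = 1.
Proof.
move=> Ga Gb ap bp.
have b2 : b ^+ (p ^ (0 + 0).+2) \in Z by rewrite expnS expgM bp expg1n.
have a1 : a ^+ (p ^ (0 + 0).+1) \in Z by rewrite expn1 ap.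
have [] := expV Gb Ga b2 a1; rewrite expn0 !expg1.
set u := [~ b, a] => Vu Zu _.
have cu y : y \in G -> y ^+ p = 1 -> commute y u.
  move=> Gy yp; apply/commute_sym; apply: (filtered_commute (@comm_trivial 1)) => //.
  by rewrite expn1 yp.
rewrite (powMp p_pr p_odd) ?ap ?bp ?mulg1 //; try exact: cu.
by rewrite -/u -commXg ?bp ?comm1g //; apply: cu.
Qed.

End Filtered.

End CommutatorOrders.

Lemma Ohm_Ldiv (gT : finGroupType) (p n : nat) (G : {group gT}) :
    p.-group G ->
    (forall a b, a \in G -> b \in G -> a ^+ (p ^ n) = 1 -> b ^+ (p ^ n) = 1 ->
       (a * b) ^+ (p ^ n) = 1) ->
  'Ohm_n(G) = 'Ldiv_(p ^ n)(G).
Proof.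
move=> pG expM; rewrite (OhmE n pG) gen_set_id //.
apply/group_setP; split=> [|a b]; first by apply/LdivP; rewrite expg1n.
by move=> /LdivP[Ga an] /LdivP[Gb bn]; apply/LdivP; rewrite groupM ?expM.
Qed.

(** * Commutator bounds in powerful groups *)

Section PowerfulOmega.

Variable p : nat.
Hypotheses (p_pr : prime p) (p_odd : odd p).

Lemma powerful_Mho_commgS (gT : finGroupType) (G : {group gT}) :
  p.-group G -> [~: G, G] \subset 'Mho^1(G) ->
  forall i u y, u \in 'Mho^i(G) -> y \in G -> [~ u, y] \in 'Mho^i.+1(G).
Proof.
move=> pG powG i u y Mu Gy.
have := subsetP (powerful_Mho_commg p_pr p_odd i 0 pG powG) [~ u, y].
by rewrite addn0 Mho0; apply; rewrite mem_commg.
Qed.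

Let Mho_filter_pow (gT : finGroupType) (G : {group gT}) :
  p.-group G -> [~: G, G] \subset 'Mho^1(G) ->
  forall i u, u \in 'Mho^i(G) ->
  exists2 w, w \in G & exists2 z, z \in 1%G & u = w ^+ (p ^ i) * z.
Proof.
move=> pG powG i u.
have [_ _ pows] := quasi_Mho p_pr p_odd i pG (powerful_quasi powG).
by case/pows=> w Gw ->; exists w => //; exists 1; rewrite ?group1 ?mulg1.
Qed.

Let comm_trivial_powerful (gT : finGroupType) (G : {group gT}) :
    p.-group G -> [~: G, G] \subset 'Mho^1(G) ->
    comm_expp p G 1%G (fun i => 'Mho^i(G)) ->
  forall i, comm_trivial_at p G 1%G i.
Proof.
move=> pG powG; apply: comm_trivial => //; last by rewrite sub1G.
- exact: powerful_Mho_commgS.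
- exact: Mho_filter_pow.
Qed.

Let expMp_powerful (gT : finGroupType) (G : {group gT}) :
    p.-group G -> [~: G, G] \subset 'Mho^1(G) ->
    comm_expp p G 1%G (fun i => 'Mho^i(G)) ->
  forall a b, a \in G -> b \in G -> a ^+ p = 1 -> b ^+ p = 1 -> (a * b) ^+ p = 1.
Proof.
move=> pG powG expG a b.
have Mcomm := powerful_Mho_commgS pG powG.
apply: (expMp_eq1 p_pr p_odd Mcomm (Mho_filter_pow pG powG)) => //.
by rewrite sub1G.
Qed.

Lemma powerful_comm_expp (gT : finGroupType) (G : {group gT}) :
    p.-group G -> [~: G, G] \subset 'Mho^1(G) ->
  comm_expp p G 1%G (fun i => 'Mho^i(G)).
Proof.
move: gT G; apply: powerful_ind => [gT G pG cGG | gT G pG nabG powG IH].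
  move=> j k h b Gh Gb _ _.
  have ->: [~ h ^+ (p ^ j), b ^+ (p ^ k)] = 1.
    by apply/eqP/commgP; apply: (centsP cGG); rewrite groupX.
  by split=> [||y Gy]; rewrite ?comm1g ?expg1n group1.
have pM : p.-group 'Mho^1(G) := pgroupS (Mho_sub 1 G) pG.
have nsMG : 'Mho^1(G) <| G by apply: gFnormal.
have M_G := powerful_Mho1_commg p_pr p_odd pG powG.
have powM : [~: 'Mho^1(G), 'Mho^1(G)] \subset 'Mho^1('Mho^1(G)).
  by apply: subset_trans M_G; rewrite commgS ?Mho_sub.
have powP x : x \in G ->
    let P := (<[x]> <*> 'Mho^1(G))%G in
    [/\ p.-group P, [~: P, P] \subset 'Mho^1(P), #|P| < #|G| & P \subset G].
  move=> Gx P; have sPG: P \subset G by rewrite join_subG cycle_subG Gx Mho_sub.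
  split=> //; [exact: pgroupS pG | | exact: Mho1_cycle_join_proper pG powG nabG Gx].
  apply: subset_trans (MhoS 1 (joing_subr _ _)).
  exact: (join_cycle_der1 nsMG M_G).
have ltMG : #|'Mho^1(G)| < #|G|.
  have [_ _ ltPG _] := powP 1 (group1 G); apply: leq_ltn_trans ltPG.
  by rewrite subset_leq_card ?joing_subr.
(* By induction on the smaller powerful group ['Mho^1(G)], this subgroup consists exactly of the
   elements of ['Mho^1(G)] killed by [p]. *)
pose N := ('Ohm_1('Mho^1(G)))%G.
have defN : N :=: 'Ldiv_p('Mho^1(G)).
  rewrite /= (@Ohm_Ldiv _ p 1) ?expn1 //.
  by apply: expMp_powerful => //; apply: IH.
have nsNG : N <| G by apply: gFnormal_trans.
have [sNG nNG] := andP nsNG.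
have pNG: p.-group (G / N) by rewrite quotient_pgroup.
have expN x m : x \in G -> x ^+ (p ^ m.+1) = 1 -> 0 < m -> x ^+ (p ^ m) \in N.
  move=> Gx xp; case: m xp => // m xp _; rewrite defN; apply/LdivP.
  rewrite -expgM -expnSr xp; split=> //.
  by rewrite expnSr expgM (mem_Mho1 pG) ?groupX.
move=> j k h b Gh Gb /set1P hp /set1P bp; set u := [~ _, _].
have Gu : u \in G by rewrite groupR ?groupX.
have Mu : u \in 'Mho^(j + k).+1(G).
  rewrite (subsetP (powerful_Mho_commg p_pr p_odd j k pG powG)) //.
  by rewrite mem_commg ?(mem_Mho_pow _ pG).
suffices Nu : u \in N.
  have N1 x : x \in N -> x ^+ p \in [1 gT] by rewrite defN => /LdivP[_ ->].
  split=> // [|y Gy]; first exact: N1.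
  by apply: N1; rewrite commgEl groupM ?groupV // memJ_norm ?(subsetP nNG).
have [jk0 | jk_gt0] := posnP (j + k).
  have [j0 k0] : j = 0 /\ k = 0.
    by move/eqP: jk0; rewrite addn_eq0 => /andP[/eqP ? /eqP ?].
  rewrite jk0 expn1 in bp; rewrite defN; apply/LdivP.
  split; first by rewrite jk0 in Mu.
  have [pP sP ltP sPG] := powP b Gb.
  have Pb : b \in <[b]> <*> 'Mho^1(G).
    by rewrite (subsetP (joing_subl _ _)) ?cycle_id.
  (* For [j = k = 0], [u] is a conjugate of [b^-1] times [b]. Both factors are killed by [p] and lie
     in the smaller powerful group [<[b]> <*> 'Mho^1(G)], which is normal as it contains the derived
     subgroup. *)
  rewrite /u j0 k0 !expg1 commgEr.
  apply: (expMp_powerful pP sP (IH _ _ pP sP ltP)) => //.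
    rewrite memJ_norm ?groupV //; apply: subsetP Gh; apply: sub_der1_norm => //.
    exact: subset_trans powG (joing_subr _ _).
  by rewrite -conjXg expgVn bp invg1 conj1g.
have ntN : N :!=: 1.
  rewrite Ohm1_eq1; apply: contra nabG => /eqP M1.
  by apply/commG1P/trivgP; rewrite -M1.
have powGN : [~: G / N, G / N] \subset 'Mho^1(G / N).
  by rewrite -quotientR // -(morphim_Mho 1 (coset_morphism N)) // quotientS.
have ltGN := ltn_quotient ntN sNG.
(* Modulo [N] both exponents drop by one, so the estimate at level [j + k] in [G / N] makes the
   image of [u] trivial. *)
have trivN := comm_trivial_powerful pNG powGN (IH _ _ pNG powGN ltGN).
have nN x : x \in G -> x \in 'N(N) by apply: subsetP.
apply: coset_idr; first exact: nN.
rewrite morphR ?groupX ?nN // !morphX ?nN //=.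
apply: (trivN (j + k)); rewrite ?mem_quotient // -morphX ?nN //= coset_id //.
  by rewrite expN.
by rewrite expN.
Qed.

End PowerfulOmega.

(** * Omega subgroups and indices *)

Section QuasiPowerfulOmega.

Variable p : nat.
Hypotheses (p_pr : prime p) (p_odd : odd p).

Lemma quasi_quotient (gT : finGroupType) (G K : {group gT}) :
  K <| G -> quasi_powerful_Mho G -> quasi_powerful_Mho (G / K)%G.
Proof.
move=> /andP[sKG nKG] qG; rewrite /quasi_powerful_Mho /= -quotientR //.
apply: subset_trans (quotientS K qG) _.
have sMG := Mho_sub 1 G; have sZG := center_sub G.
rewrite quotientY ?(subset_trans sMG) ?(subset_trans sZG) //.
rewrite -(morphim_Mho 1 (coset_morphism K) nKG) genS // setUS //.
by rewrite subsetI quotientS //= quotient_cents ?subsetIr.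
Qed.

Lemma quasi_center_quotient (gT : finGroupType) (G : {group gT}) :
  quasi_powerful_Mho G = ([~: G / 'Z(G), G / 'Z(G)] \subset 'Mho^1(G / 'Z(G))).
Proof.
have nZG : G \subset 'N('Z(G)) by apply: gFnorm.
have sMG := Mho_sub 1 G.
rewrite -quotientR // -(morphim_Mho 1 (coset_morphism _) nZG).
rewrite quotientSK; last exact: subset_trans (der_sub 1 G) nZG.
by rewrite /quasi_powerful_Mho joingC norm_joinEr ?(subset_trans sMG).
Qed.

(** The filtration is the preimage in [G] of the power subgroups of [G / 'Z(G)], and the a priori
    bound modulo the center is the one for this powerful quotient. *)
Lemma quasi_expMp_eq1 (gT : finGroupType) (G : {group gT}) a b :
    p.-group G -> quasi_powerful_Mho G -> a \in G -> b \in G ->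
    a ^+ p = 1 -> b ^+ p = 1 ->
  (a * b) ^+ p = 1.
Proof.
move=> pG qG Ga Gb; set Z := 'Z(G)%G.
have nsZG : Z <| G by apply: center_normal.
have [sZG nZG] := andP nsZG.
have nZ x : x \in G -> x \in 'N(Z) by apply: subsetP.
have pGZ : p.-group (G / Z) by rewrite quotient_pgroup.
have powGZ : [~: G / Z, G / Z] \subset 'Mho^1(G / Z).
  by rewrite -quasi_center_quotient.
pose V i := [set u in G | coset Z u \in 'Mho^i(G / Z)].
have Vcomm i u y : u \in V i -> y \in G -> [~ u, y] \in V i.+1.
  rewrite !inE => /andP[Gu Mu] Gy; rewrite groupR //= morphR ?nZ //=.
  by apply: (powerful_Mho_commgS p_pr p_odd pGZ powGZ Mu); apply: mem_quotient.
have Vpow i u : u \in V i ->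
    exists2 w, w \in G & exists2 z, z \in Z & u = w ^+ (p ^ i) * z.
  rewrite inE => /andP[Gu].
  have [_ _ pows] := quasi_Mho p_pr p_odd i pGZ (powerful_quasi powGZ).
  case/pows=> _ /morphimP[w Nw Gw ->] defu; exists w => //.
  exists ((w ^+ (p ^ i))^-1 * u); last by rewrite mulKVg.
  apply: coset_idr; first by rewrite groupM ?groupV ?groupX ?nZ.
  by rewrite morphM ?groupV ?groupX ?nZ // morphV ?groupX // morphX //= -defu mulVg.
apply: (expMp_eq1 p_pr p_odd Vcomm Vpow pG) => //.
have Z1 x : x \in Z -> coset Z x \in 1%G by move=> Zx; rewrite coset_id ?group1.
have Z1r x : x \in G -> coset Z x \in 1%G -> x \in Z.
  by move=> Gx /set1P; apply: coset_idr; apply: nZ.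
move=> j k h y Gh Gy Zh Zy.
set u := [~ h ^+ _, _].
have Gu : u \in G by rewrite groupR ?groupX.
have cosetX x m : x \in G -> coset Z (x ^+ m) = coset Z x ^+ m.
  by move=> Gx; rewrite morphX ?nZ.
have defu : [~ coset Z h ^+ (p ^ j), coset Z y ^+ (p ^ k)] = coset Z u.
  by rewrite -!cosetX // -morphR ?nZ ?groupX.
have := powerful_comm_expp p_pr p_odd pGZ powGZ (j := j) (k := k)
  (mem_quotient Z Gh) (mem_quotient Z Gy).
rewrite defu -!cosetX // => /(_ (Z1 _ Zh) (Z1 _ Zy))[Mu up uyp]; split.
- by rewrite inE Gu.
- by apply: Z1r up; apply: groupX.
move=> x Gx; have Gux : [~ u, x] \in G by rewrite groupR.
apply: Z1r; first exact: groupX.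
by rewrite cosetX // morphR ?nZ //; apply/uyp/mem_quotient.
Qed.

Lemma quasi_expM_eq1 (gT : finGroupType) (G : {group gT}) n a b :
    p.-group G -> quasi_powerful_Mho G -> a \in G -> b \in G ->
    a ^+ (p ^ n) = 1 -> b ^+ (p ^ n) = 1 ->
  (a * b) ^+ (p ^ n) = 1.
Proof.
elim: n gT G a b => [|n IHn] gT G a b pG qG Ga Gb.
  by rewrite !expg1 => -> ->; rewrite mulg1.
pose R := ('Ohm_n(G))%G.
have defR : R :=: 'Ldiv_(p ^ n)(G).
  by apply: Ohm_Ldiv => // x y Gx Gy; apply: IHn qG _ _.
have nsRG : R <| G by apply: gFnormal.
have [sRG nRG] := andP nsRG.
have nR x : x \in G -> x \in 'N(R) by apply: subsetP.
have cosetp x : x \in G -> x ^+ (p ^ n.+1) = 1 -> coset R x ^+ p = 1.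
  move=> Gx xp; rewrite -morphX ?nR //= coset_id // defR; apply/LdivP.
  by rewrite groupX // -expgM -expnS.
move=> ap bp; have Gab : a * b \in G by rewrite groupM.
suffices: (a * b) ^+ p \in R by rewrite defR => /LdivP[_]; rewrite -expgM -expnS.
apply: coset_idr; first by rewrite nR ?groupX.
rewrite morphX ?nR // morphM ?nR //=.
apply: (quasi_expMp_eq1 (quotient_pgroup R pG) (quasi_quotient nsRG qG));
  by rewrite ?mem_quotient ?cosetp.
Qed.

Lemma quasi_Ohm (gT : finGroupType) (G : {group gT}) n :
  p.-group G -> quasi_powerful_Mho G -> 'Ohm_n(G) = 'Ldiv_(p ^ n)(G).
Proof. by move=> pG qG; apply: Ohm_Ldiv => // a b; apply: quasi_expM_eq1. Qed.

(** The p-th power map followed by reduction modulo [L] is a homomorphism; its kernel is the counted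
    set and its image is ['Mho^1(G) / L]. *)
Lemma card_pow_kernel (gT : finGroupType) (G L : {group gT}) :
    p.-group G -> G \subset 'N(L) -> L \subset 'Mho^1(G) -> pow_closed p G ->
    {in G &, forall x y, (x ^+ p * y ^+ p)^-1 * (x * y) ^+ p \in L} ->
  (#|[set x in G | x ^+ p \in L]| * #|'Mho^1(G)| = #|G| * #|L|)%N.
Proof.
move=> pG nLG sLM powG mulL.
have nL x : x \in G -> x \in 'N(L) by apply: subsetP.
have fM : {in G &, {morph (fun x => coset L (x ^+ p)) : x y / x * y}}.
  move=> x y Gx Gy /=; rewrite -morphM ?nL ?groupX //=.
  apply/esym/eqP; rewrite eq_mulVg1 -morphV ?nL ?groupM ?groupX //=.
  rewrite -morphM ?nL ?groupV ?groupM ?groupX ?groupM //=.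
  by rewrite coset_id ?mulL.
pose f := Morphism fM.
have imf : f @* G = 'Mho^1(G) / L.
  apply/setP=> z; apply/morphimP/morphimP=> [[x Gx _ ->] | [y Ny My ->]].
    by exists (x ^+ p) => //; [rewrite nL ?groupX | apply: mem_Mho1].
  by have [x Gx ->] := powG y My; exists x.
have kerf : 'ker f = [set x in G | x ^+ p \in L].
  apply/setP=> x; rewrite !inE; apply: andb_id2l => Gx /=.
  apply/eqP/idP=> [|Lx]; last exact: coset_id.
  by apply: coset_idr; rewrite nL ?groupX.
have cf : (#|f @* G| * #|'ker f| = #|G|)%N.
  by rewrite card_morphim setIid mulnC Lagrange ?subsetIl.
rewrite -kerf -cf imf card_quotient ?(subset_trans (Mho_sub 1 G)) //.
by rewrite -(Lagrange sLM) mulnAC mulnC [(#|L| * _)%N]mulnC.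
Qed.

Lemma card_Ohm1_Mho1_lift (gT : finGroupType) (G M : {group gT}) :
    p.-group G -> M <| G -> [~: M, G] \subset 'Mho^1(M) -> [~: G, G] \subset M ->
    quasi_powerful_Mho G ->
    {in G, forall x, let P := <[x]> <*> M in (#|'Ohm_1(P)| * #|'Mho^1(P)| = #|P|)%N} ->
  (#|'Ohm_1(G)| * #|'Mho^1(G)| = #|G|)%N.
Proof.
move=> pG nsMG sMG sGM qG idxP; have [sMsG nMG] := andP nsMG.
have OhmE1 (H : {group gT}) : H \subset G -> 'Ohm_1(H) = 'Ldiv_p(H).
  move=> sHG; have := @Ohm_Ldiv _ p 1 H (pgroupS sHG pG); rewrite expn1; apply.
  by move=> a b /(subsetP sHG) Ga /(subsetP sHG) Gb; apply: (quasi_expMp_eq1 pG).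
(* Taking [x = 1] in the hypothesis gives [M] itself. *)
have idxM : (#|'Ohm_1(M)| * #|'Mho^1(M)| = #|M|)%N.
  by have := idxP 1 (group1 G); rewrite /= cycle1 joing1G.
have OhmI (H : {group gT}) : H \subset G -> M \subset H ->
    (#|('Ohm_1(H) * M)%g| * #|'Ohm_1(M)| = #|'Ohm_1(H)| * #|M|)%N.
  move=> sHG sMH; rewrite [RHS]mul_cardG; congr (_ * #|pred_of_set _|)%N.
  rewrite /= !OhmE1 //; apply/setP=> x; rewrite !inE.
  have [Mx | _] := boolP (x \in M); last by rewrite !andbF.
  by rewrite (subsetP sMH) ?andbT.
have defW : [set x in G | x ^+ p \in 'Mho^1(M)] = 'Ohm_1(G) * M.
  apply/eqP; rewrite eqEsubset; apply/andP; split; last first.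
    apply/subsetP=> _ /mulsgP[a m Oa Mm ->].
    have Gm := subsetP sMsG m Mm.
    move: Oa; rewrite OhmE1 // => /LdivP[Ga ap]; rewrite inE groupM //=.
    have := powM_mod_Mho1 p_pr p_odd pG nsMG sMG sGM Ga Gm.
    by rewrite ap mul1g groupMl // groupV (mem_Mho1 (pgroupS sMsG pG)).
  apply/subsetP=> y; rewrite inE => /andP[Gy yp].
  have sPG : <[y]> <*> M \subset G by rewrite join_subG cycle_subG Gy.
  have sMP : M \subset <[y]> <*> M by apply: joing_subr.
  have idxy := idxP y Gy.
  have Py : y \in <[y]> <*> M by rewrite (subsetP (joing_subl _ _)) ?cycle_id.
  apply: (subsetP (mulSg _ (OhmS 1 sPG))).
  (* For [P = <[y]> <*> M] one has ['Mho^1(P) = 'Mho^1(M)]. Comparing the index formulas of [P] and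
     [M] gives ['Ohm_1(P) * M] the order of [P]. *)
  suffices -> : 'Ohm_1(<[y]> <*> M) * M = <[y]> <*> M by [].
  apply/eqP; rewrite eqEcard mul_subG ?Ohm_sub //=.
  rewrite /= (join_cycle_Mho1 p_pr p_odd pG nsMG sMG Gy yp) in idxy.
  have := OhmI (<[y]> <*> M)%G sPG sMP; rewrite -idxM mulnA mulnAC /= idxy => /eqP.
  by rewrite eqn_pmul2r ?cardG_gt0 // => /eqP->.
have := card_pow_kernel pG (gFnorm_trans _ nMG) (MhoS 1 sMsG)
  (quasi_pow_closed p_pr p_odd pG qG)
  (fun x y Gx Gy => powM_mod_Mho1 p_pr p_odd pG nsMG sMG sGM Gx Gy).
rewrite defW => cardW.
apply/eqP; rewrite -(eqn_pmul2r (cardG_gt0 ('Mho^1(M))%G)) /= -cardW.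
rewrite mulnAC eqn_pmul2r ?cardG_gt0 // -(eqn_pmul2r (cardG_gt0 ('Ohm_1(M))%G)) /=.
by rewrite OhmI // -idxM -!mulnA [X in (_ * X)%N == _]mulnC.
Qed.

Lemma card_Ohm1_Mho1_powerful (gT : finGroupType) (G : {group gT}) :
    p.-group G -> [~: G, G] \subset 'Mho^1(G) ->
  (#|'Ohm_1(G)| * #|'Mho^1(G)| = #|G|)%N.
Proof.
move: gT G; apply: powerful_ind => gT G pG.
  move=> cGG; have powG : [~: G, G] \subset 'Mho^1(G) by rewrite (commG1P cGG) sub1G.
  have qG := powerful_quasi powG.
  (* With [L] trivial, the kernel of the p-th power map is ['Ohm_1(G)]. *)
  have := card_pow_kernel pG (norms1 G) (sub1G _) (quasi_pow_closed p_pr p_odd pG qG).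
  rewrite cards1 muln1 => <- => [|x y Gx Gy].
    congr (#|pred_of_set _| * _)%N; rewrite (quasi_Ohm 1 pG qG) expn1.
    by apply/setP=> x; rewrite !inE.
  by rewrite expgMn ?mulVg ?group1 //; apply: (centsP cGG).
move=> nabG powG IH.
have M_G := powerful_Mho1_commg p_pr p_odd pG powG.
have nsMG: 'Mho^1(G) <| G by apply: gFnormal.
apply: (card_Ohm1_Mho1_lift pG nsMG) => // [|x Gx]; first exact: powerful_quasi.
apply: (IH _ (<[x]> <*> 'Mho^1(G))%G).
- by rewrite (pgroupS _ pG) // join_subG cycle_subG Gx Mho_sub.
- by rewrite (subset_trans (join_cycle_der1 nsMG M_G Gx)) // MhoS ?joing_subr.
- exact: Mho1_cycle_join_proper pG powG nabG Gx.
Qed.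

Lemma card_Ohm1_Mho1_quasi (gT : finGroupType) (G : {group gT}) :
  p.-group G -> quasi_powerful_Mho G -> (#|'Ohm_1(G)| * #|'Mho^1(G)| = #|G|)%N.
Proof.
move=> pG qG; have M_G := quasi_core_commg p_pr p_odd pG qG.
have nsMG: 'Mho^1(G) <*> 'Z(G) <| G by rewrite normalY ?gFnormal.
apply: (card_Ohm1_Mho1_lift pG nsMG) => // x Gx.
apply: (@card_Ohm1_Mho1_powerful _ (<[x]> <*> ('Mho^1(G) <*> 'Z(G)))%G).
  by rewrite (pgroupS _ pG) // join_subG cycle_subG Gx normal_sub.
by rewrite (subset_trans (join_cycle_der1 nsMG M_G Gx)) // MhoS ?joing_subr.
Qed.

(** Induct through [R = 'Ohm_1(G)]: ['Ohm_n.+1(G)] is the preimage of ['Ohm_n(G / R)], while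
    ['Mho^n(G / R)] has the order of ['Mho^n.+1(G)]. *)
Lemma card_Ohm_Mho_quasi (gT : finGroupType) (G : {group gT}) n :
  p.-group G -> quasi_powerful_Mho G -> (#|'Ohm_n(G)| * #|'Mho^n(G)| = #|G|)%N.
Proof.
elim: n gT G => [|n IHn] gT G pG qG; first by rewrite Ohm0 Mho0 cards1 mul1n.
pose R := ('Ohm_1(G))%G; have nsRG : R <| G by apply: gFnormal.
have [sRG nRG] := andP nsRG.
have nR x : x \in G -> x \in 'N(R) by apply: subsetP.
have [qM MM _] := quasi_Mho p_pr p_odd n pG qG.
have pM : p.-group 'Mho^n(G) := pgroupS (Mho_sub n G) pG.
have defOhm : 'Ohm_n.+1(G) / R = 'Ohm_n(G / R).
  rewrite (quasi_Ohm n (quotient_pgroup R pG) (quasi_quotient nsRG qG)).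
  rewrite (quasi_Ohm n.+1 pG qG); apply/setP=> z.
  have memR x : x \in G -> (x ^+ (p ^ n) \in R) = (x ^+ (p ^ n.+1) == 1).
    move=> Gx; rewrite /R /= (quasi_Ohm 1 pG qG) !inE groupX //=.
    by rewrite -expgM -expnD addn1.
  apply/morphimP/LdivP=> [[x Nx /LdivP[Gx xp] ->]|[/morphimP[x Nx Gx ->] xp]].
    split; first exact: mem_quotient.
    by rewrite -morphX ?nR //= coset_id // memR ?xp.
  exists x => //; apply/LdivP; split=> //; apply/eqP; rewrite -memR //.
  by apply: coset_idr; rewrite ?nR ?groupX // morphX ?nR.
have cardOhm : #|'Ohm_n.+1(G)| = (#|'Ohm_n(G / R)| * #|R|)%N.
  rewrite -defOhm card_quotient ?(subset_trans (Ohm_sub _ _)) //.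
  by rewrite mulnC Lagrange // Ohm_leq.
(* ['Mho^n(G / R)] is isomorphic to ['Mho^n(G)] modulo its own ['Ohm_1]; the case of exponent one
   for ['Mho^n(G)] gives the order. *)
have cardMho : #|'Mho^n(G / R)| = #|'Mho^n.+1(G)|.
  rewrite -(morphim_Mho n (coset_morphism R) nRG) /=.
  have nRM : 'Mho^n(G) \subset 'N(R) by apply: subset_trans (Mho_sub n G) nRG.
  have defRM : R :&: 'Mho^n(G) = 'Ohm_1('Mho^n(G)).
    rewrite /R /= (quasi_Ohm 1 pG qG) (quasi_Ohm 1 pM qM).
    by rewrite setIAC (setIidPr (Mho_sub n G)).
  rewrite -(card_isog (second_isog nRM)) /= defRM card_quotient ?gFnorm //.
  rewrite -MM -divgS ?Ohm_sub // -(card_Ohm1_Mho1_quasi pM qM) /=.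
  by rewrite mulKn ?cardG_gt0.
rewrite cardOhm mulnAC -cardMho (IHn _ (G / R)%G) ?quotient_pgroup ?quasi_quotient //.
by rewrite card_quotient // mulnC Lagrange.
Qed.

End QuasiPowerfulOmega.

(** * Translation to orders of elements, sets of powers and indices *)

Theorem theorem1 (gT : finGroupType) (p : nat) (G : {group gT}) (i : nat) :
  prime p -> odd p -> p.-group G -> quasi_powerful p G ->
  [/\ (forall a b, a \in G -> b \in G -> #[a] <= p ^ i -> #[b] <= p ^ i ->
         #[a * b] <= p ^ i),
      pow_subgroup G (p ^ i) = [set x ^+ (p ^ i) | x in G],
      #|G : pow_subgroup G (p ^ i)| = #|Omega_sub p i G|
    & regular_power_structure p G].
Proof.
move=> p_pr p_odd pG qpG.
have pow_MhoE (rT : finGroupType) (H : {group rT}) n :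
    p.-group H -> pow_subgroup H (p ^ n) = 'Mho^n(H).
  by move=> pH; rewrite (MhoE n pH).
have qG : quasi_powerful_Mho G.
  by rewrite quasi_center_quotient -pow_MhoE ?quotient_pgroup // expn1.
(* Orders are powers of [p], so being at most [p ^ n] amounts to dividing it. *)
have orderE x n : x \in G -> (#[x] <= p ^ n) = (x ^+ (p ^ n) == 1).
  move=> Gx; rewrite -order_dvdn.
  have /p_natP[m ->] : p.-nat #[x] := mem_p_elt pG Gx.
  by rewrite leq_exp2l ?dvdn_Pexp2l ?prime_gt1.
have OmegaE n : Omega_sub p n G = 'Ohm_n(G).
  rewrite (OhmE n pG); congr (generated _).
  by apply/setP=> x; rewrite !inE.
have powE n : pow_subgroup G (p ^ n) = [set x ^+ (p ^ n) | x in G].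
  rewrite pow_MhoE //; have [_ _ pows] := quasi_Mho p_pr p_odd n pG qG.
  apply/setP=> y; apply/idP/imsetP=> [/pows | [x Gx ->]]; last exact: mem_Mho_pow.
  by case=> x Gx ->; exists x.
have idxE n : #|G : pow_subgroup G (p ^ n)| = #|Omega_sub p n G|.
  rewrite pow_MhoE // OmegaE -divgS ?Mho_sub //.
  by rewrite -(card_Ohm_Mho_quasi p_pr p_odd n pG qG) mulnK ?cardG_gt0.
split=> // [a b Ga Gb|n _].
  rewrite !orderE ?groupM // => /eqP an /eqP bn.
  by apply/eqP; apply: quasi_expM_eq1 qG _ _ _ _.
split=> //; rewrite OmegaE (quasi_Ohm p_pr p_odd n pG qG).
by apply/setP=> x; rewrite !inE; apply: andb_id2l => Gx; rewrite orderE.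
Qed.
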